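(* Let $\{[L(x),U(x)]\}_{x\in D}$ be the intervals at the end of Phase I of the algorithm ACE-W (described in the context), and let $$\varepsilon'_{\max}:=\max_{x\in A}\tfrac12\big(U(x)-L(x)\big),$$ where $A$ is the ambiguous set determined by these intervals. Then, on the event that these intervals are jointly valid (that is, $v(x)\in[L(x),U(x)]$ for all $x\in D$), Phase II (ACE) issues at most $O\big(m(4\varepsilon'_{\max})\big)$ strong oracle calls.
   Context: Setting. $D=\{x_1,\dots,x_n\}$ is a set of items with an unknown valuation $v:D\to[0,1]$, and $1\le k<n$. Items are totally ordered by $v$ (ties broken deterministically by a fixed index order). $t^\star=v_{(k)}$ is the $k$-th largest value. For $\eta\ge0$ the near-tie mass is $m(\eta)=|\{x\in D:|v(x)-t^\star|\le\eta\}|$. Oracles. A query to the weak oracle $\mathsf W$ on $x$ returns a random value in $[0,1]$ with mean $v(x)$ and bounded variance; repeated queries are i.i.d. A query to the strong oracle $\mathsf S$ on $x$ returns $v(x)$ exactly. Ambiguous set. Given intervals $[L(x),U(x)]$, let $L_{(k)}$, $U_{(k)}$ be the $k$-th largest values (with multiplicity) of $\{L(x)\}$ and $\{U(x)\}$. The ambiguous set is $A=\{x\in D: L(x)\le U_{(k)}\text{ and }U(x)\ge L_{(k)}\}$. Algorithm ACE-W, with input $D$, $k$, total weak budget $B$, $\delta$, $w_{\min}$, $w_{\max}$. Phase I (adaptive weak allocation): give each item $w_{\min}$ weak queries and set $B\leftarrow B-n\,w_{\min}$. While $B>0$: compute the current ambiguous set $A$ (stop the phase if $A$ is empty); choose $x^\star\in\arg\max_{x\in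 A:\,w(x)<w_{\max}}(U(x)-L(x))$, where $w(x)$ is the number of weak queries made to $x$ so far; make one weak query to $x^\star$, update its interval, and set $B\leftarrow B-1$. The intervals used are anytime-valid (time-uniform) confidence intervals: with half-width $r^{\text{any}}_w(x)$ and sample mean $\hat v_w(x)$ after $w$ queries, $\mathbb P(\forall w\ge1:|\hat v_w(x)-v(x)|\le r^{\text{any}}_w(x))\ge1-\delta/n$ for each $x$. At the end of Phase I the intervals are frozen. Phase II (ACE): starting from the frozen intervals, repeat: (a) let $S_k$ be the set of the $k$ items with largest current $U(x)$; (b) let $i\in\arg\min_{x\in S_k}L(x)$ and $j\in\arg\max_{y\notin S_k}U(y)$; (c) if $L(i)\ge U(j)$, stop and return $S_k$; (d) otherwise let $x^\star\in\{i,j\}$ be the one with larger current width $U(\cdot)-L(\cdot)$, query $v^\star=\mathsf S(x^\star)$, and set $L(x^\star)=U(x^\star)=v^\star$. *)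

(* Defs.v *)
From HB Require Import structures.
From mathcomp Require Import all_boot all_order all_algebra.
From mathcomp Require Import all_classical all_reals all_analysis.

Set Implicit Arguments.
Unset Strict Implicit.
Unset Printing Implicit Defensive.

Import Order.TTheory GRing.Theory Num.Theory.
Import numFieldNormedType.Exports.

Local Open Scope ring_scope.

(* MathComp-Analysis.  The items x_1, ..., x_n are the elements of 'I_n. *)

(* k is counted from 1, as in v_(k); ties are counted with multiplicity. *)
Definition kth_largest (R : realType) (n k : nat) (f : 'I_n -> R) : R :=
  nth 0 (sort (fun a b : R => b <= a) [seq f x | x <- enum 'I_n]) k.-1.

Definition near_tie_mass (R : realType) (n k : nat) (v : 'I_n -> R) (eta : R) :
    nat :=
  #|[set x : 'I_n | `|v x - kth_largest k v| <= eta]|.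

Definition ambiguous (R : realType) (n k : nat) (L U : 'I_n -> R) :
    {set 'I_n} :=
  [set x : 'I_n | (L x <= kth_largest k U) && (kth_largest k L <= U x)].

Definition width (R : realType) (n : nat) (L U : 'I_n -> R) (x : 'I_n) : R :=
  U x - L x.

(* The default value 0 of the maximum is harmless for valid intervals: the
   half-widths are then nonnegative. *)
Definition eps_max (R : realType) (n k : nat) (L U : 'I_n -> R) : R :=
  \big[Num.max/0]_(x in ambiguous k L U) (width L U x / 2).

Definition jointly_valid (R : realType) (n : nat) (v L U : 'I_n -> R) : Prop :=
  forall x, L x <= v x <= U x.

Definition mutually_independent (d : measure_display) (T : measurableType d)
    (R : realType) (P : probability T R) (X : nat -> {RV P >-> R}) : Prop :=
  forall (J : seq nat) (E : nat -> set R), uniq J ->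
    (forall s, measurable (E s)) ->
    P [set om | forall s, s \in J -> E s (X s om)]%classic =
    (\prod_(s <- J) P [set om | E s (X s om)]%classic)%E.

Definition identically_distributed (d : measure_display)
    (T : measurableType d) (R : realType) (P : probability T R)
    (X : nat -> {RV P >-> R}) : Prop :=
  forall (s s' : nat) (E : set R), measurable E ->
    P [set om | E (X s om)]%classic = P [set om | E (X s' om)]%classic.

(* W x s is the answer to the (s+1)-st weak query made to x. *)
Definition weak_oracle (d : measure_display) (T : measurableType d)
    (R : realType) (P : probability T R) (n : nat) (v : 'I_n -> R)
    (W : 'I_n -> nat -> {RV P >-> R}) : Prop :=
  [/\ forall x s om, 0 <= W x s om <= 1,
      forall x s, ('E_P[W x s] = (v x)%:E)%E,
      exists sigma2 : R, forall x s, ('V_P[W x s] <= sigma2%:E)%E,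
      forall x, mutually_independent (W x)
    & forall x, identically_distributed (W x)].

Definition sample_mean (d : measure_display) (T : measurableType d)
    (R : realType) (P : probability T R) (n : nat)
    (W : 'I_n -> nat -> {RV P >-> R}) (om : T) (x : 'I_n) (w : nat) : R :=
  (\sum_(s < w) W x s om) / w%:R.

(* The half-width r x w after w queries to x may depend on the sample. *)
Definition anytime_valid (d : measure_display) (T : measurableType d)
    (R : realType) (P : probability T R) (n : nat) (v : 'I_n -> R)
    (W r : 'I_n -> nat -> {RV P >-> R}) (delta : R) : Prop :=
  forall x : 'I_n,
    ((1 - delta / n%:R)%:E <=
     P [set om | forall w, (0 < w)%N ->
                 (`|sample_mean W om x w - v x| <= r x w om)%R]%classic)%E.

(* The interval of x after w weak queries to it; an item that has not been
   queried has the trivial interval [0, 1]. *)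
Definition ci_lo (d : measure_display) (T : measurableType d)
    (R : realType) (P : probability T R) (n : nat)
    (W r : 'I_n -> nat -> {RV P >-> R}) (om : T) (x : 'I_n) (w : nat) : R :=
  if w is 0%N then 0 else sample_mean W om x w - r x w om.

Definition ci_up (d : measure_display) (T : measurableType d)
    (R : realType) (P : probability T R) (n : nat)
    (W r : 'I_n -> nat -> {RV P >-> R}) (om : T) (x : 'I_n) (w : nat) : R :=
  if w is 0%N then 1 else sample_mean W om x w + r x w om.

(* The items of the ambiguous set that may still receive a weak query, given
   the numbers c of queries made so far. *)
Definition eligible (R : realType) (n k wmax : nat)
    (lo up : 'I_n -> nat -> R) (c : 'I_n -> nat) : {set 'I_n} :=
  [set x in ambiguous k (fun y => lo y (c y)) (fun y => up y (c y))
     | (c x < wmax)%N].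

(* adaptive_phase k wmax lo up b c c': with remaining budget b and query
   counts c, the loop of the weak phase may end with the query counts c'.  It
   ends when the budget is exhausted or no item is eligible, in particular
   when the ambiguous set is empty.  Ties in the argmax are left open. *)
Inductive adaptive_phase (R : realType) (n k wmax : nat)
    (lo up : 'I_n -> nat -> R) :
    nat -> ('I_n -> nat) -> ('I_n -> nat) -> Prop :=
| adaptive_stop b c :
    b = 0%N \/ eligible k wmax lo up c = finset.set0 ->
    adaptive_phase k wmax lo up b c c
| adaptive_query b c c' x :
    x \in eligible k wmax lo up c ->
    (forall y, y \in eligible k wmax lo up c ->
       width (fun z => lo z (c z)) (fun z => up z (c z)) y <=
       width (fun z => lo z (c z)) (fun z => up z (c z)) x) ->
    adaptive_phase k wmax lo up b
      (fun y => if y == x then (c y).+1 else c y) c' ->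
    adaptive_phase k wmax lo up b.+1 c c'.

(* L and U are interval endpoints with which the weak phase of total budget B
   may end on the outcome om. *)
Definition weak_phase_end (d : measure_display) (T : measurableType d)
    (R : realType) (P : probability T R) (n k B wmin wmax : nat)
    (W r : 'I_n -> nat -> {RV P >-> R}) (om : T) (L U : 'I_n -> R) : Prop :=
  exists c : 'I_n -> nat,
    [/\ adaptive_phase k wmax (ci_lo W r om) (ci_up W r om)
          (B - n * wmin)%N (fun=> wmin) c,
        L = (fun x => ci_lo W r om x (c x))
      & U = (fun x => ci_up W r om x (c x))].

Definition top_set (R : realType) (n k : nat) (U : 'I_n -> R)
    (S : {set 'I_n}) : Prop :=
  #|S| = k /\ forall x y, x \in S -> y \notin S -> U y <= U x.

Definition reveal (R : realType) (n : nat) (v f : 'I_n -> R) (x : 'I_n) :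
    'I_n -> R :=
  fun y => if y == x then v y else f y.

(* One iteration of ACE that does not stop, querying the strong oracle, which
   answers v x, on the item x.  Ties in S, i, j and x are left open. *)
Definition ace_query (R : realType) (n k : nat) (L U : 'I_n -> R)
    (x : 'I_n) : Prop :=
  exists (S : {set 'I_n}) (i j : 'I_n),
    [/\ top_set k U S,
        i \in S /\ (forall y, y \in S -> L i <= L y),
        j \notin S /\ (forall y, y \notin S -> U y <= U j),
        ~ U j <= L i
      & x \in [:: i; j] /\
        forall y, y \in [:: i; j] -> width L U y <= width L U x].

(* ace_calls k v L U q: q is the sequence of strong oracle calls issued by
   some number of iterations of ACE started from L and U.  Executions that
   have not stopped yet are included, so a bound on size q valid for all q
   also says that ACE stops. *)
Inductive ace_calls (R : realType) (n k : nat) (v : 'I_n -> R) :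
    ('I_n -> R) -> ('I_n -> R) -> seq 'I_n -> Prop :=
| ace_no_call L U : ace_calls k v L U [::]
| ace_call L U x q :
    ace_query k L U x ->
    ace_calls k v (reveal v L x) (reveal v U x) q ->
    ace_calls k v L U (x :: q).

(* Main.v *)
(* Let i and j be the two candidates of a non-stopping iteration, with current
   intervals [L', U'].  Validity and the choice of S, i, j force
   L'(i) <= v_(k) <= U'(i) and L'(i) < U'(j) <= U'(i), and put i and j in the
   initial ambiguous set.  Both widths are then at most 2 eps_max, so the
   queried item lies within 4 eps_max of v_(k).  It has positive width (otherwise
   U'(j) <= U'(i) = L'(i)) and gets width zero, so no item is queried twice; the
   constant is 1. *)
Require Import Defs.
From HB Require Import structures.
From mathcomp Require Import all_boot all_order all_algebra.
From mathcomp Require Import all_classical all_reals all_analysis.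
From mathcomp Require Import lra.
Import Order.TTheory GRing.Theory Num.Theory.
Import numFieldNormedType.Exports.
Local Open Scope ring_scope.

Section KthLargest.
Context {R : realType} {n : nat}.
Implicit Types (k : nat) (f : 'I_n -> R) (t : R).

Let vals f := sort (fun a b : R => b <= a) [seq f x | x <- enum 'I_n].

Let size_vals f : size (vals f) = n.
Proof. by rewrite size_sort size_map size_enum_ord. Qed.

Let nth_vals f p q : (p <= q < n)%N -> nth 0 (vals f) q <= nth 0 (vals f) p.
Proof.
move=> /andP[pq qn].
have geT : transitive (fun a b : R => b <= a).
  by move=> y x z yx zy; apply: le_trans zy yx.
apply: (sorted_leq_nth geT (fun x : R => lexx x)) => //.
- by apply: sort_sorted => a b; apply: le_total.
- by rewrite inE size_vals (leq_ltn_trans pq).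
- by rewrite inE size_vals.
Qed.

Let count_vals f (p : pred R) : count p (vals f) = #|[set x | p (f x)]|.
Proof.
rewrite (permP (permEl (perm_sort _ _))) count_map cardE -size_filter.
by congr size; rewrite enumT; apply: eq_filter => x /=; rewrite inE.
Qed.

(** If entry [k.-1] of the decreasing list were below [t], so would be all later ones, leaving at
    most [k.-1] entries that reach [t]. *)
Lemma kth_largest_ge k f t : (0 < k <= n)%N ->
  (k <= #|[set x | (t <= f x)%R]|)%N -> t <= kth_largest k f.
Proof.
move=> /andP[k0 kn]; apply: contraTT; rewrite -ltNge -ltnNge => ft.
rewrite -(count_vals f (>= t)) -(cat_take_drop k.-1 (vals f)) count_cat.
rewrite (_ : count _ (drop _ _) = 0%N).
  rewrite addn0 (leq_ltn_trans (count_size _ _))//.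
  by rewrite size_takel ?ltn_predL// size_vals (leq_trans (leq_pred k)).
apply/eqP; rewrite eqn0Ngt -has_count; apply/hasPn => y /(nthP 0)[p].
rewrite size_drop size_vals nth_drop => hp <-.
by rewrite -ltNge (le_lt_trans _ ft)// nth_vals// leq_addr -ltn_subRL.
Qed.

(** Dually, if entry [k.-1] exceeded [t], so would the whole prefix of length [k]. *)
Lemma kth_largest_le k f t : (0 < k <= n)%N ->
  (#|[set x | (t < f x)%R]| < k)%N -> kth_largest k f <= t.
Proof.
move=> /andP[k0 kn]; apply: contraTT; rewrite -ltNge -leqNgt => ft.
have sz : size (take k (vals f)) = k by rewrite size_takel ?size_vals.
rewrite -(count_vals f (> t)) -(cat_take_drop k (vals f)) count_cat.
rewrite (_ : count _ (take _ _) = k) ?leq_addr// -[RHS]sz.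
apply/eqP; rewrite -all_count; apply/(all_nthP 0) => p; rewrite sz => pk.
rewrite nth_take// (lt_le_trans ft)// nth_vals// -ltnS prednK// pk.
by rewrite (leq_trans _ kn)// ltn_predL.
Qed.

End KthLargest.

Section Ace.
Context {R : realType} {n : nat}.
Implicit Types (k : nat) (v L U : 'I_n -> R) (x : 'I_n) (q : seq 'I_n).

Lemma width_le_eps_max k L U x :
  x \in ambiguous k L U -> width L U x <= 2 * eps_max k L U.
Proof.
move=> xA; have : width L U x / 2 <= eps_max k L U by apply: le_bigmax_cond.
lra.
Qed.

Lemma ace_query_width_gt0 k L U x : ace_query k L U x -> 0 < width L U x.
Proof.
case=> S [i [j [[_ topS] [iS _] [jS _] /negP]]].
rewrite -ltNge => Lij [_ wx].
(* The queried item is the wider candidate, so positivity for [i] is enough even when [j] is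
   queried. *)
apply: (@lt_le_trans _ _ (width L U i)); last by rewrite wx ?mem_head.
by have := topS _ _ iS jS; rewrite /width; lra.
Qed.

Lemma width_reveal v L U x y :
  width (reveal v L x) (reveal v U x) y = if y == x then 0 else width L U y.
Proof. by rewrite /width /reveal; case: ifP; rewrite ?subrr. Qed.

(** The positive widths strengthen the induction: once revealed, [x] has width zero and so cannot
    occur among the later calls. *)
Lemma ace_calls_uniq k v L U q : ace_calls k v L U q ->
  uniq q /\ {in q, forall x, 0 < width L U x}.
Proof.
elim=> [//|{}L {}U x {}q /ace_query_width_gt0 wx _ [uq wq]]; split=> /=.
  by rewrite uq andbT; apply/negP => /wq; rewrite width_reveal eqxx ltxx.
move=> y; rewrite inE => /predU1P[->//|/wq].
by rewrite width_reveal; case: eqP => // _; rewrite ltxx.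
Qed.

(** Invariant of the strong phase. Nesting in the initial intervals lets facts about current
    candidates be read back at the start. *)
Definition refines v L U L' U' :=
  forall x, [/\ L x <= L' x, L' x <= v x, v x <= U' x & U' x <= U x].

Lemma refines_refl v L U : jointly_valid v L U -> refines v L U L U.
Proof. by move=> valid x; have /andP[] := valid x. Qed.

Lemma refines_reveal v L U L' U' x : refines v L U L' U' ->
  refines v L U (reveal v L' x) (reveal v U' x).
Proof.
move=> ref y; have [LL' L'v vU' U'U] := ref y; rewrite /reveal.
by case: ifP => _; split=> //; lra.
Qed.

Lemma ace_query_near_tie k v L U L' U' x : (0 < k <= n)%N ->
  refines v L U L' U' -> ace_query k L' U' x ->
  `|v x - kth_largest k v| <= 4 * eps_max k L U.
Proof.
move=> kn ref [S [i [j [[cS topS] [iS minL] [jS maxU] /negP]]]].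
rewrite -ltNge => Lij [xij _].
have Uji : U' j <= U' i by exact: topS.
(* Outside [S], [f] is at most [U' j], hence at most [t]; so only the [k.-1] items of [S] other than
   [i] can exceed [t]. Applied below to [L] and to [v]. *)
have small t f : t >= U' j -> f i <= t -> (forall y, f y <= U' y) ->
    (#|[set y | (t < f y)%R]| < k)%N.
  move=> Ujt fit fU'; rewrite -cS (cardsD1 i S) iS ltnS; apply: subset_leq_card.
  apply/fintype.subsetP => y; rewrite !inE => tfy.
  have [yi|_/=] := eqVneq y i; first by move: tfy; rewrite yi; lra.
  by apply: contraT => /maxU; have := fU' y; lra.
(* The level [U' j] separates: the [k] items of [S] have [U] at least [U' j], while fewer than [k]
   items have [L] above [U y]. The intervals of both [i] and [j] contain this level. *)
have amb y : L' y <= U' j -> U' j <= U' y -> y \in ambiguous k L U.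
  move=> Lyj Ujy; rewrite inE; have [LL' _ _ U'U] := ref y; apply/andP; split.
    apply: kth_largest_ge => //; rewrite -[leqLHS]cS; apply: subset_leq_card.
    apply/fintype.subsetP => z zS; rewrite inE.
    by have := topS _ _ zS jS; have [_ _ _] := ref z; lra.
  apply: kth_largest_le => //; apply: small => [|| z].
  - lra.
  - by have [] := ref i; lra.
  - by have [] := ref z; lra.
have wE y : L' y <= U' j -> U' j <= U' y -> U' y - L' y <= 2 * eps_max k L U.
  move=> Lyj Ujy; have := width_le_eps_max _ _ _ _ (amb y Lyj Ujy).
  by rewrite /width; have [] := ref y; lra.
have wi := wE i (ltW Lij) Uji.
have [_ Lvj vUj _] := ref j; have [_ Lvi vUi _] := ref i.
have wj := wE j (le_trans Lvj vUj) (lexx _).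
have tL : L' i <= kth_largest k v.
  apply: kth_largest_ge => //; rewrite -[leqLHS]cS; apply: subset_leq_card.
  apply/fintype.subsetP => z zS; rewrite inE.
  by have := minL _ zS; have [] := ref z; lra.
have tU : kth_largest k v <= U' i.
  apply: kth_largest_le => //; apply: small => // z.
  by have [] := ref z.
(* The intervals of [i] and [j] share the point [U' j], and the first contains the [k]-th largest
   value; for [x = j] the two widths add up to the factor 4. *)
by move: xij; rewrite !inE => /orP[]/eqP->; rewrite ler_norml; apply/andP; lra.
Qed.

(** The initial [L], [U] stay fixed while the induction moves [L'], [U'], so every call is measured
    against the same [eps_max]. *)
Lemma ace_calls_near_tie k v L U L' U' q : (0 < k <= n)%N ->
  refines v L U L' U' -> ace_calls k v L' U' q ->
  {in q, forall x, `|v x - kth_largest k v| <= 4 * eps_max k L U}.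
Proof.
move=> kn + calls; elim: calls => [//|{}L' {}U' x {}q qx _ IH ref y].
rewrite inE => /predU1P[->|]; first exact: ace_query_near_tie ref qx.
by apply: IH; exact: refines_reveal.
Qed.

Lemma size_ace_calls k v L U q : (0 < k <= n)%N -> jointly_valid v L U ->
  ace_calls k v L U q -> (size q <= near_tie_mass k v (4 * eps_max k L U))%N.
Proof.
move=> kn valid calls; have [uq _] := ace_calls_uniq _ _ _ _ _ calls.
rewrite -(card_uniqP uq); apply/subset_leq_card/fintype.subsetP => x xq.
by rewrite inE (ace_calls_near_tie _ _ _ _ _ _ _ kn (refines_refl _ _ _ valid) calls).
Qed.

End Ace.

Theorem theorem8 :
  exists C : nat,
  forall (R : realType) (d : measure_display) (T : measurableType d)
    (P : probability T R) (n k : nat) (v : 'I_n -> R)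
    (B wmin wmax : nat) (delta : R) (W r : 'I_n -> nat -> {RV P >-> R}),
    (1 <= k < n)%N ->
    (forall x, 0 <= v x <= 1) ->
    weak_oracle v W ->
    anytime_valid v W r delta ->
  forall (om : T) (L U : 'I_n -> R),
    weak_phase_end k B wmin wmax W r om L U ->
    jointly_valid v L U ->
  forall q : seq 'I_n,
    ace_calls k v L U q ->
    (size q <= C * near_tie_mass k v (4 * eps_max k L U))%N.
Proof.
exists 1%N => R d T P n k v B wmin wmax delta W r /andP[k0 kn] _ _ _ om L U _.
by move=> valid q calls; rewrite mul1n size_ace_calls// k0 ltnW.
Qed.
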